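(* Let $E_1,E_2,E_3$ be real vector spaces, $E_\mu=\mathbb{R}^{n_\mu}$ with the standard inner product, and let $\mathbf{X}\in E_1\otimes E_2\otimes E_3$. Let $(U_\mu)_{\mu}$, $U_\mu\in\mathbb{R}^{n_\mu\times r_\mu}$, be the HOSVD basis and $\mathbf{C}$ the HOSVD core of $\mathbf{X}$ at multilinear rank $\mathbf{r}=(r_1,r_2,r_3)$, so that $\mathbf{X}$ is expressed as $$\mathbf{X}=\sum_{i=1}^{r_1}\sum_{j=1}^{r_2}\sum_{k=1}^{r_3}C_{ijk}\,\mathbf{u}^1_i\otimes\mathbf{u}^2_j\otimes\mathbf{u}^3_k .$$ Let $\Sigma_\mu$ be the diagonal matrix of singular values of $X^{(\mu)}$ associated with the columns of $U_\mu$, and let $Y_\mu=U_\mu\Sigma_\mu$ be the principal components of mode $\mu$. If $r_\mu\le\operatorname{rank}(X^{(\mu)})$ for $\mu\in\{1,2,3\}$, then $$\begin{aligned} Y_1&=X^{(1)}(Y_3\otimes_K Y_2)(B^{(1)})^{T},\\ Y_2&=X^{(2)}(Y_3\otimes_K Y_1)(B^{(2)})^{T},\\ Y_3&=X^{(3)}(Y_2\otimes_K Y_1)(B^{(3)})^{T}, \end{aligned}$$ where $\mathbf{B}=(\Sigma_1^{-1},\Sigma_2^{-1},\Sigma_3^{-1})\mathbf{C}$.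
   Context: For a tensor $\mathbf{A}\in\mathbb{R}^{n_1\times\dots\times n_d}$, the matricization $A^{(\mu)}$ with respect to mode $\mu$ is the matrix with $n_\mu$ rows and $\prod_{\alpha\neq\mu}n_\alpha$ columns whose entry in row $i_\mu$ and column $\overline{i_1,\dots,i_{\mu-1},i_{\mu+1},\dots,i_d}=1+\sum_{\alpha\ne\mu}(i_\alpha-1)m_\alpha$, with $m_\alpha=\prod_{\beta<\alpha,\ \beta\neq\mu}n_\beta$, is $A_{i_1\dots i_d}$. $\otimes_K$ is the Kronecker product of matrices. For matrices $M_\mu$ of compatible size, $(M_1,\dots,M_d)\mathbf{A}$ is the tensor-times-matrix product: $(M_1,\dots,M_d)(\mathbf{a}_1\otimes\dots\otimes\mathbf{a}_d)=M_1\mathbf{a}_1\otimes\dots\otimes M_d\mathbf{a}_d$, extended linearly. HOSVD of $\mathbf{X}$ at multilinear rank $\mathbf{r}$: for each mode $\mu$, the matrix $U_\mu\in\mathbb{R}^{n_\mu\times r_\mu}$ has as its columns $\mathbf{u}^\mu_1,\dots,\mathbf{u}^\mu_{r_\mu}$ orthonormal left singular vectors of $X^{(\mu)}$ associated with its $r_\mu$ largest singular values $\sigma^{(\mu)}_1\ge\dots\ge\sigma^{(\mu)}_{r_\mu}$; $\Sigma_\mu=\operatorname{diag}(\sigma^{(\mu)}_1,\dots,\sigma^{(\mu)}_{r_\mu})$; and the core is $\mathbf{C}=(U_1^{T},\dots,U_d^{T})\mathbf{X}\in\mathbb{R}^{r_1\times\dots\times r_d}$. *)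

(* Defs.v *)
From mathcomp Require Import all_boot all_order all_algebra.
From mathcomp.reals Require Import reals.
From mathcomp Require Import ring.
From mathcomp.real_closed Require Export mxtens.

Set Implicit Arguments.
Unset Strict Implicit.
Unset Printing Implicit Defensive.

Import Order.TTheory GRing.Theory Num.Theory.
Local Open Scope ring_scope.

(* E_1 (x) E_2 (x) E_3 with E_mu = R^(n_mu), in coordinates; the codomain is
   the regular module R^o so that tensors form an R-module. *)
Notation tensor R n1 n2 n3 := {ffun 'I_n1 * 'I_n2 * 'I_n3 -> R^o}.

Definition outer (R : realType) (n1 n2 n3 : nat)
    (a : 'cV[R]_n1) (b : 'cV[R]_n2) (c : 'cV[R]_n3) : tensor R n1 n2 n3 :=
  [ffun x => a x.1.1 0 * b x.1.2 0 * c x.2 0].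

(* (M1, M2, M3) A: the linear extension of a (x) b (x) c |-> M1 a (x) M2 b (x)
   M3 c, computed from the decomposition of A on the canonical basis, using that
   M maps the i-th canonical basis vector to col i M. *)
Definition ttm (R : realType) (m1 m2 m3 n1 n2 n3 : nat)
    (M1 : 'M[R]_(m1, n1)) (M2 : 'M[R]_(m2, n2)) (M3 : 'M[R]_(m3, n3))
    (A : tensor R n1 n2 n3) : tensor R m1 m2 m3 :=
  \sum_(i < n1) \sum_(j < n2) \sum_(k < n3)
    A (i, j, k) *: outer (col i M1) (col j M2) (col k M3).

Lemma ttm_outer (R : realType) (m1 m2 m3 n1 n2 n3 : nat)
    (M1 : 'M[R]_(m1, n1)) (M2 : 'M[R]_(m2, n2)) (M3 : 'M[R]_(m3, n3))
    (a : 'cV[R]_n1) (b : 'cV[R]_n2) (c : 'cV[R]_n3) :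
  ttm M1 M2 M3 (outer a b c) = outer (M1 *m a) (M2 *m b) (M3 *m c).
Proof.
apply/ffunP => -[[p q] s]; rewrite /ttm /outer !ffunE /= !mxE sum_ffunE.
rewrite -mulrA mulr_suml; apply: eq_bigr => i _.
rewrite sum_ffunE mulr_suml mulr_sumr; apply: eq_bigr => j _.
rewrite sum_ffunE !mulr_sumr; apply: eq_bigr => k _.
rewrite !ffunE /= !mxE -[_ *: _]/(_ * _); ring.
Qed.

Lemma ttm_linear (R : realType) (m1 m2 m3 n1 n2 n3 : nat)
    (M1 : 'M[R]_(m1, n1)) (M2 : 'M[R]_(m2, n2)) (M3 : 'M[R]_(m3, n3)) :
  linear (ttm M1 M2 M3).
Proof.
move=> a A B; rewrite /ttm scaler_sumr -big_split; apply: eq_bigr => i _ /=.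
rewrite scaler_sumr -big_split; apply: eq_bigr => j _ /=.
rewrite scaler_sumr -big_split; apply: eq_bigr => k _ /=.
by rewrite !ffunE scalerDl scalerA.
Qed.

(* mxtens_index (i, j) : 'I_(m * n) has value i * n + j, hence the column index
   with the lower mode running fastest (i2 + n2 * i3, counting from 0, for mode
   1) is the one of the pair (higher mode, lower mode). *)
Definition matricize1 (R : realType) (n1 n2 n3 : nat) (A : tensor R n1 n2 n3) :
    'M[R]_(n1, n3 * n2) :=
  \matrix_(i, c) A (i, (mxtens_unindex c).2, (mxtens_unindex c).1).

Definition matricize2 (R : realType) (n1 n2 n3 : nat) (A : tensor R n1 n2 n3) :
    'M[R]_(n2, n3 * n1) :=
  \matrix_(j, c) A ((mxtens_unindex c).2, j, (mxtens_unindex c).1).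

Definition matricize3 (R : realType) (n1 n2 n3 : nat) (A : tensor R n1 n2 n3) :
    'M[R]_(n3, n2 * n1) :=
  \matrix_(k, c) A ((mxtens_unindex c).2, (mxtens_unindex c).1, k).

(* Economy size: a full SVD restricts to one and every economy SVD extends to a
   full one, so both give the same leading singular vectors. *)
Record is_svd (R : realType) (m n : nat) (A : 'M[R]_(m, n))
    (P : 'M[R]_(m, minn m n)) (d : 'rV[R]_(minn m n))
    (Q : 'M[R]_(n, minn m n)) : Prop := IsSVD {
  svd_left : P^T *m P = 1%:M;
  svd_right : Q^T *m Q = 1%:M;
  svd_ge0 : forall i, 0 <= d 0 i;
  svd_sorted : forall i j : 'I_(minn m n), (i <= j)%N -> d 0 j <= d 0 i;
  svd_eq : A = P *m diag_mx d *m Q^T }.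

(* Any choice of singular vectors is allowed, since the SVD is existentially
   quantified; r cannot exceed the number minn m n of singular values. *)
Definition leading_left_singular (R : realType) (m n r : nat)
    (A : 'M[R]_(m, n)) (U : 'M[R]_(m, r)) (s : 'rV[R]_r) : Prop :=
  exists (le_r : (r <= minn m n)%N) (P : 'M[R]_(m, minn m n))
         (d : 'rV[R]_(minn m n)) (Q : 'M[R]_(n, minn m n)),
    [/\ is_svd A P d Q,
        U = colsub (widen_ord le_r) P
      & s = colsub (widen_ord le_r) d].

Record is_hosvd (R : realType) (n1 n2 n3 r1 r2 r3 : nat)
    (X : tensor R n1 n2 n3)
    (U1 : 'M[R]_(n1, r1)) (U2 : 'M[R]_(n2, r2)) (U3 : 'M[R]_(n3, r3))
    (s1 : 'rV[R]_r1) (s2 : 'rV[R]_r2) (s3 : 'rV[R]_r3)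
    (C : tensor R r1 r2 r3) : Prop := IsHOSVD {
  hosvd_mode1 : leading_left_singular (matricize1 X) U1 s1;
  hosvd_mode2 : leading_left_singular (matricize2 X) U2 s2;
  hosvd_mode3 : leading_left_singular (matricize3 X) U3 s3;
  hosvd_core : C = ttm U1^T U2^T U3^T X }.

(* Main.v *)
Require Import Defs.
From mathcomp Require Import all_boot all_order all_algebra.
From mathcomp.reals Require Import reals.
From mathcomp Require Import ring.

Import Order.TTheory GRing.Theory Num.Theory.
Local Open Scope ring_scope.

Set Implicit Arguments.
Unset Strict Implicit.

(** The three equations are one matrix identity, read in the three modes.
    Matricizing [X = (U1, U2, U3) C] in a given mode gives [A = U K W^T], where
    [A] and [K] are the matricizations of [X] and [C], [U] is the factor of that
    mode and [W] is the Kronecker product of the other two factors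
    ([matricize1_ttm] and its companions).  The same rule applied to [B] gives
    [S^-1 K T^-T], where [T] is the Kronecker product of the other two diagonal
    matrices.  The product with the other principal components, [W T], is
    therefore multiplied by [T^-1 K^T S^-1], so [T] cancels, and what remains is
    [A (U K W^T)^T U S^-1] because [U^T U = 1], that is [A A^T U S^-1].  Since
    the columns of [U] are left singular vectors, [A A^T U = U S^2]
    ([gram_mul_left_singular]), and the result is [U S].

    The cancellations need [S] to be invertible in each mode, which is where the
    bound on [r] enters: the rank of [A] is at most the number of its nonzero
    singular values ([leading_singular_unitmx]). *)

(** * Leading singular vectors *)

Section LeadingSingular.

Variables (R : realType) (m n r : nat).
Variables (A : 'M[R]_(m, n)) (U : 'M[R]_(m, r)) (s : 'rV[R]_r).
Hypothesis svdA : leading_left_singular A U s.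

Lemma leading_left_singular_orthonormal : U^T *m U = 1%:M.
Proof.
case: svdA => le_r [P [d [Q [[PP _ _ _ _] -> _]]]].
have -> : (colsub (widen_ord le_r) P)^T *m colsub (widen_ord le_r) P
  = mxsub (widen_ord le_r) (widen_ord le_r) (P^T *m P).
  by rewrite mxsub_mul; congr (_ *m _); apply/matrixP => i j; rewrite !mxE.
by rewrite PP; apply/matrixP => i j; rewrite !mxE.
Qed.

(** The squared singular values are the eigenvalues of the Gram matrix: in
    [A A^T = P D^2 P^T] the orthonormal columns of [P] are eigenvectors. *)
Lemma gram_mul_left_singular :
  A *m A^T *m U = U *m diag_mx s *m diag_mx s.
Proof.
case: svdA => le_r [P [d [Q [[PP QQ _ _ ->] -> ->]]]].
rewrite !trmx_mul trmxK tr_diag_mx !mulmxA -(mulmxA (P *m _)) QQ mulmx1.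
rewrite mulmx_colsub -(mulmxA _ P^T) PP mulmx1 !mul_mx_diag.
by apply/matrixP => i j; rewrite !mxE.
Qed.

(** If the [i]-th singular value vanishes then, by monotonicity, so do all later
    ones; the diagonal factor of the decomposition is then supported on its
    first [i] rows, and [A] has rank at most [i < r]. *)
Lemma leading_singular_unitmx : (r <= \rank A)%N -> diag_mx s \in unitmx.
Proof.
case: svdA => le_r [P [d [Q [[_ _ d_ge0 d_sorted A_eq] _ ->]]]] le_rank.
rewrite unitmxE det_diag unitfE; apply/prodf_neq0 => i _; rewrite mxE.
apply: contraTneq le_rank => di0; rewrite -ltnNge.
have diagE : diag_mx d = pid_mx i *m diag_mx d.
  apply/matrixP => j k; rewrite mul_mx_diag !mxE val_eqE.
  have [<-{k}|_] := eqVneq j k; last by rewrite mul0r.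
  have [_|ij] := ltnP j i; first by rewrite mul1r.
  rewrite mul0r mulr1n; apply: le_anti.
  by rewrite d_ge0 andbT -[leRHS]di0 d_sorted.
have i_le : (i <= minn m n)%N := leq_trans (ltnW (ltn_ord i)) le_r.
rewrite A_eq; apply: leq_ltn_trans (mxrankM_maxl _ _) _.
apply: leq_ltn_trans (mxrankM_maxr _ _) _; rewrite diagE.
by apply: leq_ltn_trans (mxrankM_maxl _ _) _; rewrite rank_pid_mx.
Qed.

(** The identity common to the three modes; [W] stands for the Kronecker
    product of the factors of the other modes, [T] for that of their singular
    values, and [K] for the matricized core. *)
Lemma principal_components_matricized (p : nat) (K : 'M[R]_(r, p))
    (W : 'M[R]_(n, p)) (T T' : 'M[R]_p) :
    (r <= \rank A)%N -> A = U *m K *m W^T -> T *m T' = 1%:M ->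
  U *m diag_mx s = A *m (W *m T) *m (invmx (diag_mx s) *m K *m T'^T)^T.
Proof.
move=> le_rank A_eq TT'.
have Su := leading_singular_unitmx le_rank.
have AU : A^T *m U = W *m K^T.
  rewrite A_eq !trmx_mul trmxK -!mulmxA.
  by rewrite leading_left_singular_orthonormal mulmx1.
rewrite !trmx_mul trmxK trmx_inv tr_diag_mx !mulmxA.
rewrite -(mulmxA _ T) TT' mulmx1 -(mulmxA A) -AU mulmxA.
by rewrite gram_mul_left_singular mulmxK.
Qed.

End LeadingSingular.

(** * Kronecker products *)

Lemma tens_scalar11 (R : pzRingType) (m n : nat) :
  tensmx (1%:M : 'M[R]_m) (1%:M : 'M[R]_n) = 1%:M.
Proof.
apply/matrixP => i j.
by rewrite !mxE -natrM mulnb -(can_eq (@mxtens_unindexK m n)) xpair_eqE.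
Qed.

Lemma sum_mxtens_index (V : nmodType) (m n : nat) (F : 'I_m -> 'I_n -> V) :
  \sum_(c < m * n) F (mxtens_unindex c).1 (mxtens_unindex c).2 =
  \sum_(i < m) \sum_(j < n) F i j.
Proof.
rewrite pair_bigA (reindex (@mxtens_unindex m n)) //=.
by exists (@mxtens_index m n) => c _; rewrite (mxtens_indexK, mxtens_unindexK).
Qed.

(** With the paired column index undone, the right-hand side of each
    matricization rule has the same form as [ttmE], up to the order in which the
    three sums are taken. *)
Lemma mulmx_tens_trE (R : pzRingType) (l l' m m' n n' : nat)
    (L : 'M[R]_(l', l)) (K : 'M[R]_(l, m * n))
    (M : 'M[R]_(m', m)) (N : 'M[R]_(n', n)) p c :
  (L *m K *m (tensmx M N)^T) p c =
  \sum_(a < l) \sum_(i < m) \sum_(j < n)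
    L p a * K a (mxtens_index (i, j)) *
    (M (mxtens_unindex c).1 i * N (mxtens_unindex c).2 j).
Proof.
rewrite -mulmxA mxE; apply: eq_bigr => a _; rewrite -sum_mxtens_index.
rewrite mxE mulr_sumr; apply: eq_bigr => e _.
by rewrite !mxE -surjective_pairing mxtens_unindexK mulrA.
Qed.

(** * Matricization of a tensor-times-matrix product *)

Section MatricizeTtm.

Variables (R : realType) (m1 m2 m3 n1 n2 n3 : nat).
Variables (M1 : 'M[R]_(m1, n1)) (M2 : 'M[R]_(m2, n2)) (M3 : 'M[R]_(m3, n3)).
Variable A : tensor R n1 n2 n3.

Lemma ttmE p q t : ttm M1 M2 M3 A (p, q, t) =
  \sum_(i < n1) \sum_(j < n2) \sum_(k < n3)
    M1 p i * M2 q j * M3 t k * A (i, j, k).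
Proof.
rewrite /ttm sum_ffunE; apply: eq_bigr => i _.
rewrite sum_ffunE; apply: eq_bigr => j _.
rewrite sum_ffunE; apply: eq_bigr => k _.
by rewrite !ffunE /= !mxE -[_ *: _]/(_ * _) mulrC.
Qed.

Lemma matricize1_ttm : matricize1 (ttm M1 M2 M3 A) =
  M1 *m matricize1 A *m (tensmx M3 M2)^T.
Proof.
apply/matrixP => p c; rewrite mulmx_tens_trE mxE ttmE.
apply: eq_bigr => i _; rewrite exchange_big /=.
apply: eq_bigr => k _; apply: eq_bigr => j _.
by rewrite mxE mxtens_indexK /=; ring.
Qed.

Lemma matricize2_ttm : matricize2 (ttm M1 M2 M3 A) =
  M2 *m matricize2 A *m (tensmx M3 M1)^T.
Proof.
apply/matrixP => p c; rewrite mulmx_tens_trE mxE ttmE exchange_big /=.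
apply: eq_bigr => j _; rewrite exchange_big /=.
apply: eq_bigr => k _; apply: eq_bigr => i _.
by rewrite mxE mxtens_indexK /=; ring.
Qed.

Lemma matricize3_ttm : matricize3 (ttm M1 M2 M3 A) =
  M3 *m matricize3 A *m (tensmx M2 M1)^T.
Proof.
apply/matrixP => p c; rewrite mulmx_tens_trE mxE ttmE exchange_big /=.
under eq_bigr do rewrite exchange_big /=.
rewrite exchange_big /=.
apply: eq_bigr => k _; apply: eq_bigr => j _; apply: eq_bigr => i _.
by rewrite mxE mxtens_indexK /=; ring.
Qed.

End MatricizeTtm.

(** * Principal components of the HOSVD *)

Unset Implicit Arguments.
Set Strict Implicit.

Theorem proposition1 (R : realType) (n1 n2 n3 r1 r2 r3 : nat)
    (X : tensor R n1 n2 n3)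
    (U1 : 'M[R]_(n1, r1)) (U2 : 'M[R]_(n2, r2)) (U3 : 'M[R]_(n3, r3))
    (s1 : 'rV[R]_r1) (s2 : 'rV[R]_r2) (s3 : 'rV[R]_r3)
    (C : tensor R r1 r2 r3)
    (hosvdX : is_hosvd X U1 U2 U3 s1 s2 s3 C)
    (X_eq : X = \sum_(i < r1) \sum_(j < r2) \sum_(k < r3)
                  C (i, j, k) *: outer (col i U1) (col j U2) (col k U3))
    (le_r1 : (r1 <= \rank (matricize1 X))%N)
    (le_r2 : (r2 <= \rank (matricize2 X))%N)
    (le_r3 : (r3 <= \rank (matricize3 X))%N) :
  let S1 := diag_mx s1 in
  let S2 := diag_mx s2 in
  let S3 := diag_mx s3 in
  let Y1 := U1 *m S1 in
  let Y2 := U2 *m S2 in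
  let Y3 := U3 *m S3 in
  let B := ttm (invmx S1) (invmx S2) (invmx S3) C in
  [/\ Y1 = matricize1 X *m tensmx Y3 Y2 *m (matricize1 B)^T,
      Y2 = matricize2 X *m tensmx Y3 Y1 *m (matricize2 B)^T
    & Y3 = matricize3 X *m tensmx Y2 Y1 *m (matricize3 B)^T].
Proof.
case: hosvdX => svd1 svd2 svd3 _ /=.
have S1u := leading_singular_unitmx svd1 le_r1.
have S2u := leading_singular_unitmx svd2 le_r2.
have S3u := leading_singular_unitmx svd3 le_r3.
(* The given expansion of [X] is the definition of this product, unfolded. *)
have X_ttm : X = ttm U1 U2 U3 C := X_eq.
have tensV (a b : nat) (S : 'M[R]_a) (T : 'M[R]_b) :
    S \in unitmx -> T \in unitmx ->
    tensmx S T *m tensmx (invmx S) (invmx T) = 1%:M.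
  by move=> Su Tu; rewrite tensmx_mul !mulmxV // tens_scalar11.
split; rewrite -tensmx_mul (matricize1_ttm, matricize2_ttm, matricize3_ttm).
- apply: principal_components_matricized; rewrite ?tensV //.
  by rewrite {1}X_ttm matricize1_ttm.
- apply: principal_components_matricized; rewrite ?tensV //.
  by rewrite {1}X_ttm matricize2_ttm.
- apply: principal_components_matricized; rewrite ?tensV //.
  by rewrite {1}X_ttm matricize3_ttm.
Qed.
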